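(* Let $\mathbb L\subseteq\mathbb R^g$ be a full rank lattice and let $\mathbb T^g=\mathbb R^g/\mathbb L$ be the $g$-dimensional torus with metric induced from the $\ell^2$ norm, i.e. $d_{\ell^2}([\mathbf x],[\mathbf y])=\min_{\boldsymbol\tau\in\mathbb L}\|\mathbf x-\mathbf y-\boldsymbol\tau\|_2$. For any $\mathbf x,\mathbf y\in\mathbb R^g$, if $\|\mathbf x-\mathbf y\|_2\le\frac12\lambda(\mathbb L)$, then $d_{\ell^2}([\mathbf x],[\mathbf y])=\|\mathbf x-\mathbf y\|_2$.
   Context: $\lambda(\mathbb L)=\min_{\boldsymbol\tau\in\mathbb L\setminus\{\mathbf 0\}}\|\boldsymbol\tau\|_2$ is the length of a shortest nonzero vector of $\mathbb L$. $[\mathbf x]$ denotes the class of $\mathbf x$ in $\mathbb R^g/\mathbb L$. *)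

(* Defs.v *)
From HB Require Import structures.
From mathcomp Require Import all_boot all_order all_algebra.
From mathcomp Require Import generic_quotient ring_quotient.
From mathcomp Require Import boolp classical_sets reals.
From mathcomp Require Import zify lra.

Set Implicit Arguments.
Unset Strict Implicit.
Unset Printing Implicit Defensive.

Import Order.TTheory GRing.Theory Num.Theory.
Local Open Scope classical_set_scope.
Local Open Scope ring_scope.

(* The norm that MathComp-Analysis puts on row vectors is the sup norm, hence
   this separate definition. *)
Definition l2norm (R : realType) (g : nat) (v : 'rV[R]_g) : R :=
  Num.sqrt (\sum_(i < g) v 0 i ^+ 2).

(* A full rank lattice is the set of integral combinations of the rows of some
   invertible matrix, i.e. of some R-basis of R^g. *)
Record fullRankLattice (R : realType) (g : nat) := FullRankLattice {
  lattice_pred :> {pred 'rV[R]_g};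
  lattice_basis : exists2 B : 'M[R]_g, B \in unitmx &
    forall v : 'rV[R]_g, v \in lattice_pred <->
      exists z : 'rV[int]_g, v = map_mx intr z *m B }.

Lemma lattice_zmod_closed (R : realType) (g : nat) (L : fullRankLattice R g) :
  zmod_closed (lattice_pred L).
Proof.
have [B _ LB] := lattice_basis L; split.
  by apply/LB; exists 0; rewrite map_mx0 mul0mx.
move=> u v /LB [z ->] /LB [w ->]; apply/LB; exists (z - w).
by rewrite map_mxB mulmxBl.
Qed.

HB.instance Definition _ (R : realType) (g : nat) (L : fullRankLattice R g) :=
  GRing.isZmodClosed.Build 'rV[R]_g (lattice_pred L) (lattice_zmod_closed L).

Definition torus (R : realType) (g : nat) (L : fullRankLattice R g) :=
  Quotient.quot (lattice_pred L).

Definition torus_class (R : realType) (g : nat) (L : fullRankLattice R g)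
  (x : 'rV[R]_g) : torus L := (\pi_(torus L) x)%qT.

(* The infima below are minima: see lambda_min and torus_dist_min. The exception
   is lambda for g = 0, an infimum over the empty set, which is 0. *)
Definition lambda (R : realType) (g : nat) (L : fullRankLattice R g) : R :=
  inf [set l2norm tau | tau in [set t | t \in L /\ t != 0]].

(* The choice of representatives is irrelevant: see torus_distE. *)
Definition torus_dist (R : realType) (g : nat) (L : fullRankLattice R g)
  (u v : torus L) : R :=
  inf [set l2norm (repr u - repr v - tau) | tau in [set t | t \in L]].

Lemma l2norm_ge_coord (R : realType) (g : nat) (v : 'rV[R]_g) (i : 'I_g) :
  `|v 0 i| <= l2norm v.
Proof.
rewrite -sqrtr_sqr ler_sqrt; last by apply: sumr_ge0 => j _; exact: sqr_ge0.
by rewrite (bigD1 i) //= lerDl; apply: sumr_ge0 => j _; exact: sqr_ge0.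
Qed.

Lemma lattice_attains_min (R : realType) (g : nat) (L : fullRankLattice R g)
    (x : 'rV[R]_g) (S : set 'rV[R]_g) :
  S `<=` [set t | t \in L] -> S !=set0 ->
  exists2 tau, S tau & forall t, S t -> l2norm (x - tau) <= l2norm (x - t).
Proof.
move=> SL [t0 St0]; have [B uB LB] := lattice_basis L.
pose r := l2norm (x - t0).
pose c := \sum_(i < g) \sum_(j < g) (`|x 0 i| + r) * `|invmx B i j|.
have r_ge0 : 0 <= r by exact: sqrtr_ge0.
have c_ge0 : 0 <= c.
  by do 2![apply: sumr_ge0 => ? _]; rewrite mulr_ge0 // addr_ge0.
pose M := `|Num.floor c|%N.
have cM : forall n : int, `|n%:~R| <= c -> `|n| <= M%:Z.
  move=> n; rewrite -intr_norm -floor_ge_int => nc.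
  by rewrite /M gez0_abs // floor_ge_int.
have bnd (z : 'rV[int]_g) : l2norm (x - map_mx intr z *m B) <= r ->
    forall j, `|z 0 j| <= M%:Z.
  move=> zr j; apply: cM; set t := _ *m B in zr.
  have -> : (z 0 j)%:~R = (t *m invmx B) 0 j by rewrite mulmxK // mxE.
  rewrite mxE; apply: le_trans (ler_norm_sum _ _ _) _.
  apply: ler_sum => i _; rewrite (bigD1 j) //= normrM.
  apply: ler_wpDr.
    by apply: sumr_ge0 => k _; rewrite mulr_ge0 // addr_ge0.
  apply: ler_wpM2r => //; have := l2norm_ge_coord (x - t) i; rewrite !mxE => ti.
  have := ler_normB (x 0 i) (x 0 i - t 0 i).
  by rewrite subKr !mxE; lra.
pose dec (f : {ffun 'I_g -> 'I_(M.*2.+1)}) : 'rV[R]_g :=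
  map_mx intr (\row_j ((f j : nat)%:Z - M%:Z) : 'rV[int]_g) *m B.
have decP t : S t -> l2norm (x - t) <= r -> exists f, t = dec f.
  move=> St tr; have /LB [z tE] := SL _ St; subst t.
  exists [ffun j => inord (absz (z 0%R j + M%:Z)%R)]; congr (map_mx _ _ *m B).
  apply/rowP => j; rewrite mxE ffunE.
  have := bnd z tr j; rewrite ler_norml => /andP[lo hi].
  rewrite inordK; last by lia.
  by lia.
have [f0 t0E] := decP _ St0 (lexx _).
pose P f := `[< S (dec f) >].
have Pf0 : P f0 by apply/asboolP; rewrite -t0E.
have [f /asboolP Sf fmin] := arg_minP (fun f => l2norm (x - dec f)) Pf0.
exists (dec f) => // t St; case: (lerP (l2norm (x - t)) r) => [tr|/ltW rt].
  by have [h th] := decP _ St tr; rewrite th; apply: fmin; apply/asboolP; rewrite -th.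
by apply: le_trans rt; rewrite /r t0E; exact: fmin.
Qed.

Lemma inf_eq_min (R : realType) (A : set R) (m : R) :
  A m -> lbound A m -> inf A = m.
Proof.
move=> Am lbm; apply/eqP; rewrite eq_le; apply/andP; split.
  by apply: ge_inf => //; exists m.
by apply: lb_le_inf => //; exists m.
Qed.

Lemma lambda_min (R : realType) (g : nat) (L : fullRankLattice R g) :
  (0 < g)%N ->
  exists tau, [/\ tau \in L, tau != 0, lambda L = l2norm tau &
    forall t, t \in L -> t != 0 -> lambda L <= l2norm t].
Proof.
move=> g_gt0; have [B uB LB] := lattice_basis L.
have [||tau [Lt t0] tmin] := @lattice_attains_min R g L 0
    [set t | -t \in L /\ - t != 0].
- by move=> t [+ _] /=; rewrite rpredN.
- pose i : 'I_g := Ordinal g_gt0; exists (- row i B); rewrite /= opprK; split.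
    apply/LB; exists (delta_mx 0 i); rewrite rowE; congr (_ *m B).
    by apply/matrixP => a b; rewrite !mxE; case: (_ && _).
  apply/eqP => /(congr1 (mulmx^~ (invmx B))); rewrite mul0mx rowE mulmxK //.
  by move=> /matrixP /(_ 0 i) /eqP; rewrite !mxE !eqxx oner_eq0.
have E : lambda L = l2norm (- tau).
  apply: inf_eq_min; first by exists (- tau).
  move=> _ [t [Lt' t0'] <-]; have := tmin (- t).
  by rewrite !sub0r /= opprK; apply.
exists (- tau); split => // t Lt' t0'; rewrite E.
by have := tmin (- t); rewrite !sub0r /= opprK; apply.
Qed.

Lemma torus_distE (R : realType) (g : nat) (L : fullRankLattice R g)
    (x y : 'rV[R]_g) :
  torus_dist (torus_class L x) (torus_class L y) =
  inf [set l2norm (x - y - tau) | tau in [set t | t \in L]].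
Proof.
have rP z : repr (torus_class L z) - z \in L.
  by rewrite Quotient.idealrBE reprK.
rewrite /torus_dist; congr (inf _); apply/seteqP; split => _ [t Lt <-].
  pose a := repr (torus_class L x) - x; pose b := repr (torus_class L y) - y.
  exists (t - (a - b)); first by apply: rpredB => //; exact: rpredB (rP x) (rP y).
  by congr l2norm; apply/rowP => i; rewrite !mxE; lra.
pose a := repr (torus_class L x) - x; pose b := repr (torus_class L y) - y.
exists (t + (a - b)); first by apply: rpredD => //; exact: rpredB (rP x) (rP y).
by congr l2norm; apply/rowP => i; rewrite !mxE; lra.
Qed.

Lemma torus_dist_min (R : realType) (g : nat) (L : fullRankLattice R g)
    (x y : 'rV[R]_g) :
  exists2 tau, tau \in L &
    torus_dist (torus_class L x) (torus_class L y) = l2norm (x - y - tau) /\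
    forall t, t \in L -> l2norm (x - y - tau) <= l2norm (x - y - t).
Proof.
have [//||tau Lt tmin] := @lattice_attains_min R g L (x - y) [set t | t \in L].
  by exists 0; exact: rpred0.
exists tau => //; split => //; rewrite torus_distE; apply: inf_eq_min.
  by exists tau.
by move=> _ [t Lt' <-]; exact: tmin.
Qed.

(* Main.v *)
Require Import Defs.
From mathcomp Require Import all_boot all_order all_algebra.
From mathcomp Require Import reals.
From mathcomp Require Import classical_sets lra.

Import Order.TTheory GRing.Theory Num.Theory.
Local Open Scope ring_scope.

(** With v = x - y, the claim is that 0 is a lattice point nearest to v. A nonzero t in L satisfies
    |v| <= [lambda L] / 2 <= |t| / 2 by [lambda_le], so v is at least as far from t as from 0
    ([l2norm_le_sub]). That last fact comes from the parallelogram law for v - t and v, whose sum is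
    2 v - t and whose difference is -t. *)

Lemma l2norm_ge0 (R : realType) (g : nat) (v : 'rV[R]_g) : 0 <= l2norm v.
Proof. exact: sqrtr_ge0. Qed.

Lemma sqr_l2norm (R : realType) (g : nat) (v : 'rV[R]_g) :
  l2norm v ^+ 2 = \sum_(i < g) v 0 i ^+ 2.
Proof. by rewrite sqr_sqrtr //; apply: sumr_ge0 => i _; exact: sqr_ge0. Qed.

(** The infimum is over a set bounded below by 0, so it lies below each member; the argument is
    uniform in g, whereas [lambda_min] assumes [0 < g]. *)
Lemma lambda_le (R : realType) (g : nat) (L : fullRankLattice R g)
    (t : 'rV[R]_g) :
  t \in L -> t != 0 -> lambda L <= l2norm t.
Proof.
move=> Lt t0; apply: ge_inf; last by exists t.
by exists 0 => _ [s _ <-]; exact: l2norm_ge0.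
Qed.

(* [2 |v - t|^2 - 2 |v|^2 = |t|^2 - 4 |v|^2 + |2 v - t|^2] *)
Lemma l2norm_le_sub (R : realType) (g : nat) (v t : 'rV[R]_g) :
  l2norm v <= 2^-1 * l2norm t -> l2norm v <= l2norm (v - t).
Proof.
move=> vt; have v0 := l2norm_ge0 _ _ v.
have vt2 : 4 * l2norm v ^+ 2 <= l2norm t ^+ 2 by nra.
rewrite -ler_sqr ?nnegrE ?l2norm_ge0 //.
suff E : 2 * l2norm (v - t) ^+ 2 - 2 * l2norm v ^+ 2 =
    l2norm t ^+ 2 - 4 * l2norm v ^+ 2 + l2norm (v + v - t) ^+ 2.
  (* Drop the square |2 v - t|^2; what remains is nonnegative by [vt2]. *)
  by have := sqr_ge0 (l2norm (v + v - t)); lra.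
rewrite !sqr_l2norm !mulr_sumr -!sumrB -big_split /=.
by apply: eq_bigr => i _; rewrite !mxE; lra.
Qed.

Theorem theorem5p13 (R : realType) (g : nat)
    (L : fullRankLattice R g) (x y : 'rV[R]_g) :
  l2norm (x - y) <= 2^-1 * lambda L ->
  torus_dist (torus_class L x) (torus_class L y) = l2norm (x - y).
Proof.
move=> xy; rewrite torus_distE; apply: inf_eq_min.
  (* The lattice vector 0 attains the value; it remains to see that no other does better. *)
  by exists 0; [exact: rpred0 | rewrite subr0].
move=> _ [t Lt <-]; have [->|t0] := eqVneq t 0; first by rewrite subr0.
apply: l2norm_le_sub; apply: le_trans xy _.
by rewrite ler_pM2l ?invr_gt0 ?ltr0n //; exact: lambda_le.
Qed.
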